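(* (Implicative Visser's rules for $\mathsf{iK_{d*}}$) Let $I$ be a finite set (possibly empty), $\{m_i\}_{i \in I}$ be a sequence of natural numbers, $k$ a natural number, and let $A_i,B_i$ ($i\in I$), $C$, $D$ be $\mathcal{L}_*$-formulas. If $$\mathsf{iK_{d*}} \vdash \Big[\bigwedge_{i \in I} \nabla^{m_i} (A_i \rightarrow B_i)\Big] \rightarrow \nabla^k(C \to D),$$ then one of the following holds: - $\mathsf{iK_{d*}} \vdash [\bigwedge_{i \in I} \nabla^{m_i}(A_i \to B_i)] \rightarrow \nabla^{m_{i_0}-1} A_{i_0}$, for some $i_0 \in I$ with $m_{i_0} \geq 1$; - $\mathsf{iK_{d*}} \vdash [\bigwedge_{i \in I'} \nabla^{m_i-k+1}(A_i \to B_i) \wedge C] \rightarrow D$, for some $I' \subseteq I$ such that $m_i \geq k$ for all $i \in I'$.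
   Context: Language and sequents. Fix a set $V$ of atomic propositions. $\mathcal{L}_*$-formulas are built from atoms in $V$ and the constants $\top,\bot$ using binary connectives $\wedge,\vee,\to$ and the unary connective $\nabla$. $\nabla^n A$ is the $n$-fold application of $\nabla$ to $A$, and $\nabla\Gamma=\{\nabla A \mid A\in\Gamma\}$ as a multiset. $\bigwedge$ denotes finite iterated conjunction, with the empty conjunction equal to $\top$. Natural numbers include $0$. A sequent over $\mathcal{L}_*$ is an expression $\Gamma\Rightarrow\Delta$ with $\Gamma,\Delta$ finite multisets of $\mathcal{L}_*$-formulas, $\Delta$ containing at most one formula. Comma is multiset union; a formula stands for its singleton. Calculus $\mathbf{STL(N)}$ (over $\mathcal{L}_*$). Rules are written ''premises / conclusion''; $\Gamma,\Sigma$ are arbitrary finite multisets, $\Delta$ has at most one formula, $A,B$ are arbitrary $\mathcal{L}_*$-formulas. Axioms: $(Id)$ $A\Rightarrow A$; $(L\bot)$ $\bot\Rightarrow$; $(R\top)$ $\Rightarrow\top$. $(Lw)$ $\Gamma\Rightarrow\Delta$ / $\Gamma,A\Rightarrow\Delta$. $(Rw)$ $\Gamma\Rightarrow$ / $\Gamma\Rightarrow A$. $(Lc)$ $\Gamma,A,A\Rightarrow\Delta$ / $\Gamma,A\Rightarrow\Delta$. $(cut)$ $\Gamma\Rightarrow A$ and $\Sigma,A\Rightarrow\Delta$ / $\Sigma,\Gamma\Rightarrow\Delta$. $(L\wedge_1)$ $\Gamma,A\Rightarrow\Delta$ / $\Gamma,A\wedge B\Rightarrow\Delta$. $(L\wedge_2)$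 $\Gamma,B\Rightarrow\Delta$ / $\Gamma,A\wedge B\Rightarrow\Delta$. $(R\wedge)$ $\Gamma\Rightarrow A$ and $\Gamma\Rightarrow B$ / $\Gamma\Rightarrow A\wedge B$. $(L\vee)$ $\Gamma,A\Rightarrow\Delta$ and $\Gamma,B\Rightarrow\Delta$ / $\Gamma,A\vee B\Rightarrow\Delta$. $(R\vee_1)$ $\Gamma\Rightarrow A$ / $\Gamma\Rightarrow A\vee B$. $(R\vee_2)$ $\Gamma\Rightarrow B$ / $\Gamma\Rightarrow A\vee B$. $(N)$ $\Gamma\Rightarrow\Delta$ / $\nabla\Gamma\Rightarrow\nabla\Delta$. $(L\to)$ $\Gamma\Rightarrow A$ and $\Gamma,B\Rightarrow\Delta$ / $\Gamma,\nabla(A\to B)\Rightarrow\Delta$. $(R\to)$ $\nabla\Gamma,A\Rightarrow B$ / $\Gamma\Rightarrow A\to B$. The logic $\mathsf{iK_{d*}}$ is the set of $\mathcal{L}_*$-formulas $A$ such that $\Rightarrow A$ has a proof-tree in $\mathbf{STL(N)}$; $\mathsf{iK_{d*}}\vdash A$ means $A\in\mathsf{iK_{d*}}$. *)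

(* Defs.v *)
From Stdlib Require Import Permutation.
From mathcomp Require Import all_boot.

Set Implicit Arguments.
Unset Strict Implicit.
Unset Printing Implicit Defensive.

Inductive form (V : Type) : Type :=
| Var of V
| Top
| Bot
| And of form V & form V
| Or of form V & form V
| Imp of form V & form V
| Nabla of form V.

Arguments Top {V}.
Arguments Bot {V}.

Definition nablan (V : Type) (n : nat) (A : form V) : form V :=
  iter n (@Nabla V) A.

(* The one-element conjunction is the formula itself; no trailing Top. *)
Fixpoint bigAnd (V : Type) (s : seq (form V)) : form V :=
  match s with
  | [::] => Top
  | [:: A] => A
  | A :: s' => And A (bigAnd s')
  end.

(* A finite multiset is represented by a list, with the rule [Exch]           *)
(* identifying lists up to permutation, so that [A :: G] stands for "G, A".   *)
(* A succedent, having at most one formula, is an option.                     *)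
Inductive STLN (V : Type) : seq (form V) -> option (form V) -> Prop :=
| Exch G G' D : Permutation G G' -> STLN G D -> STLN G' D
| Id A : STLN [:: A] (Some A)
| LBot : STLN [:: Bot] None
| RTop : STLN [::] (Some Top)
| Lw G A D : STLN G D -> STLN (A :: G) D
| Rw G A : STLN G None -> STLN G (Some A)
| Lc G A D : STLN (A :: A :: G) D -> STLN (A :: G) D
| Cut G S A D : STLN G (Some A) -> STLN (A :: S) D -> STLN (S ++ G) D
| LAnd1 G A B D : STLN (A :: G) D -> STLN (And A B :: G) D
| LAnd2 G A B D : STLN (B :: G) D -> STLN (And A B :: G) D
| RAnd G A B : STLN G (Some A) -> STLN G (Some B) -> STLN G (Some (And A B))
| LOr G A B D : STLN (A :: G) D -> STLN (B :: G) D -> STLN (Or A B :: G) D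
| ROr1 G A B : STLN G (Some A) -> STLN G (Some (Or A B))
| ROr2 G A B : STLN G (Some B) -> STLN G (Some (Or A B))
| RuleN G D : STLN G D -> STLN (map (@Nabla V) G) (omap (@Nabla V) D)
| LImp G A B D : STLN G (Some A) -> STLN (B :: G) D ->
    STLN (Nabla (Imp A B) :: G) D
| RImp G A B : STLN (A :: map (@Nabla V) G) (Some B) -> STLN G (Some (Imp A B)).

(* Membership in the logic iK_{d*}. *)
Definition iKd (V : Type) (A : form V) : Prop := STLN [::] (Some A).

(* Main.v *)
Require Import Defs.
From Stdlib Require Import Permutation Classical.
From mathcomp Require Import all_boot.

(** The proof is a Kleene-style slash argument.

    Semantically, [Nabla] acts like the inverse image along a function [f] on
    worlds: [Nabla A] holds at [w] when [A] holds at [f w]. Since [Imp A B] is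
    right adjoint to [Nabla _ /\ A], it holds at [w] when, at every [v] with
    [w <= f v], [A] implies [B]. Given contexts [G 0], [G 1], ... such that
    [G n] proves [Nabla F] for every [F] in [G n.+1], one can glue to the
    models of the logic a chain of new worlds [r 0], [r 1 = f (r 0)], ..., with
    [r n] lying below all the worlds that satisfy [G n]. Truth at [r n] is the
    predicate [slash G n]: an implication is true at [r n] when it is provable
    from [G n] (which takes care of the old worlds) and, if [n = n'.+1], is
    respected at [r n'], the only new world that [f] sends to [r n]. What is
    slashed at [n] is provable from [G n] ([slash_provable]), and each rule of
    the calculus preserves truth at every [r n] ([slash_sound]).

    Now let [G n] consist of the [Nabla^(m i - n) (A i -> B i)] with
    [n <= m i]. Such a hypothesis of [G 0] is true at [r 0] if and only if
    [A i -> B i] is true at [r (m i)]; as it is provable from [G (m i)], this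
    can fail only if [m i >= 1] and [A i] is true at [r (m i - 1)]. But then
    [G (m i - 1)] proves [A i], hence [G 0] proves [Nabla^(m i - 1) (A i)],
    which is the first alternative. Otherwise all the hypotheses are true at
    [r 0], hence so is [Nabla^k (C -> D)]; that is, [C -> D] is true at [r k],
    so [G k] proves [C -> D]. Inverting the implication rule, [Nabla (G k)]
    and [C] prove [D], which is the second alternative with
    [I' = {i | k <= m i}]. *)

Set Implicit Arguments.
Unset Strict Implicit.
Unset Printing Implicit Defensive.

(** * Admissible rules of the calculus *)

Lemma STLN_weak_cat (V : Type) (S G : seq (form V)) D :
  STLN G D -> STLN (S ++ G) D.
Proof. by move=> GD; elim: S => //= F S IH; apply: Lw. Qed.

Lemma STLN_ax (V : Type) (G : seq (form V)) F :
  List.In F G -> STLN G (Some F).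
Proof.
elim: G => //= F' G IH [-> | /IH]; last exact: Lw.
apply: (Exch (G := G ++ [:: F])).
  exact: Permutation_sym (Permutation_cons_append _ _).
exact/STLN_weak_cat/Id.
Qed.

Lemma STLN_contract_cat (V : Type) (G S : seq (form V)) D :
  STLN (G ++ G ++ S) D -> STLN (G ++ S) D.
Proof.
elim: G S => //= F G IH S H; apply: Lc.
(* The two copies of the head are moved past [G], into the side context. *)
have mid T : Permutation (F :: G ++ T) (G ++ F :: T).
  exact: Permutation_middle.
have perm2 : Permutation (F :: F :: G ++ S) (G ++ F :: F :: S).
  exact: Permutation_trans (perm_skip _ (mid _)) (mid _).
apply/(Exch (Permutation_sym perm2))/IH; apply: Exch H.
exact: Permutation_trans (mid _) (Permutation_app_head _ perm2).
Qed.

Lemma STLN_multicut (V : Type) (G S : seq (form V)) D :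
  (forall F, List.In F S -> STLN G (Some F)) -> STLN S D -> STLN G D.
Proof.
move=> GS SD.
suff: STLN (S ++ G) D -> STLN G D.
  apply; apply: Exch (STLN_weak_cat G SD).
  exact: Permutation_app_comm.
elim: S GS {SD} => //= F S IH GS H.
apply: IH => [F' SF'|]; first by apply: GS; right.
have {}H := Cut (GS F (or_introl erefl)) H.
have permG : Permutation ((S ++ G) ++ G) (G ++ G ++ S).
  apply: Permutation_trans (Permutation_app_comm _ _) _.
  exact/Permutation_app_head/Permutation_app_comm.
apply: (Exch (Permutation_app_comm G S)).
exact/STLN_contract_cat/(Exch permG).
Qed.

Lemma STLN_modus_ponens (V : Type) (A B : form V) :
  STLN [:: Nabla (Imp A B); A] (Some B).
Proof. by apply: LImp; apply: STLN_ax; left. Qed.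

Lemma STLN_imp_inv (V : Type) (G : seq (form V)) A B :
  STLN G (Some (Imp A B)) -> STLN (A :: map (@Nabla V) G) (Some B).
Proof.
move=> GAB; apply: STLN_multicut (STLN_modus_ponens A B) => F /=.
case=> [<- | [<- | //]]; last by apply: STLN_ax; left.
exact/Lw/(RuleN GAB).
Qed.

Lemma iKd_imp (V : Type) (A B : form V) :
  iKd (Imp A B) <-> STLN [:: A] (Some B).
Proof. by split=> [/STLN_imp_inv | H]; [| apply: RImp]. Qed.

Lemma STLN_bigAnd_elim (V : Type) (s : seq (form V)) F :
  List.In F s -> STLN [:: bigAnd s] (Some F).
Proof.
elim: s => //= F1 [|F2 s] IH sF.
  by case: sF => // ->; apply: Id.
by case: sF => [->|/IH]; [apply/LAnd1/Id | apply: LAnd2].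
Qed.

Lemma STLN_bigAnd_left (V : Type) (s : seq (form V)) D :
  STLN s D -> STLN [:: bigAnd s] D.
Proof. by apply: STLN_multicut => F; apply: STLN_bigAnd_elim. Qed.

(** * The slash along a chain of contexts *)

(** [slash G n A] is truth of [A] at the [n]-th new world. Atoms are false at
    the new worlds: these lie below the old ones, so any valuation there that
    stays below provability would be persistent. *)
Fixpoint slash (V : Type) (G : nat -> seq (form V)) (n : nat) (A : form V) :
    Prop :=
  match A with
  | Var _ => False
  | Top => True
  | Bot => False
  | And A B => slash G n A /\ slash G n B
  | Or A B => slash G n A \/ slash G n B
  | Imp A B => STLN (G n) (Some (Imp A B)) /\
      if n is n'.+1 then slash G n' A -> slash G n' B else True
  | Nabla A => slash G n.+1 A
  end.

Definition nabla_chain (V : Type) (G : nat -> seq (form V)) : Prop :=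
  forall n F, List.In F (G n.+1) -> STLN (G n) (Some (Nabla F)).

Lemma nabla_chain_shift (V : Type) (G : nat -> seq (form V)) n A :
  nabla_chain G -> STLN (G n.+1) (Some A) -> STLN (G n) (Some (Nabla A)).
Proof.
move=> chainG /RuleN; apply: STLN_multicut => F /List.in_map_iff[F' [<-]].
exact: chainG.
Qed.

Lemma nabla_chain_root (V : Type) (G : nat -> seq (form V)) n A :
  nabla_chain G -> STLN (G n) (Some A) -> STLN (G 0) (Some (nablan n A)).
Proof.
move=> chainG; elim: n A => //= n IH A /(nabla_chain_shift chainG)/IH.
by rewrite /nablan -iterSr.
Qed.

(** Persistence from the new worlds to the old ones. *)
Lemma slash_provable (V : Type) (G : nat -> seq (form V)) n A :
  nabla_chain G -> slash G n A -> STLN (G n) (Some A).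
Proof.
move=> chainG.
elim: A n => //= [|A IHA B IHB|A IHA B IHB|A _ B _|A IHA] n.
- by move=> _; rewrite -[G n]cats0; apply/STLN_weak_cat/RTop.
- by case=> /IHA HA /IHB HB; apply: RAnd.
- by case=> [/IHA|/IHB]; [apply: ROr1 | apply: ROr2].
- by case.
- by move/IHA/(nabla_chain_shift chainG).
Qed.

(** The rules [LImp] and [RuleN] are local to the worlds [n] and [n.+1]. For
    [RImp] at [n.+1], the slash of the context at [n.+1] is that of its image
    under [Nabla] at [n], where the premise applies; provability from [G n]
    comes from [slash_provable] by cuts. *)
Lemma slash_sound (V : Type) (G : nat -> seq (form V)) (S : seq (form V)) D :
  nabla_chain G -> STLN S D ->
  forall n, (forall F, List.In F S -> slash G n F) ->
  if D is Some A then slash G n A else False.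
Proof.
move=> chainG; elim=> {S D}.
- move=> S S' D permS _ IH n HS'; apply: IH => F /(Permutation_in _ permS).
  exact: HS'.
- by move=> A n; apply; left.
- by move=> n /(_ Bot (or_introl erefl)).
- by [].
- by move=> S A D _ IH n HS; apply: IH => F SF; apply: HS; right.
- by move=> S A _ IH n /IH.
- move=> S A D _ IH n HS; apply: IH => F [<-|SF]; last exact: HS.
  by apply: HS; left.
- move=> S T A D _ IHA _ IHD n HTS; apply: IHD => F [<-|TF].
    by apply: IHA => E SE; apply/HTS/List.in_app_iff; right.
  by apply/HTS/List.in_app_iff; left.
- move=> S A B D _ IH n HS; apply: IH => F [<-|SF]; last by apply: HS; right.
  by case: (HS _ (or_introl erefl)).
- move=> S A B D _ IH n HS; apply: IH => F [<-|SF]; last by apply: HS; right.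
  by case: (HS _ (or_introl erefl)).
- by move=> S A B _ IHA _ IHB n HS; split; [apply: IHA | apply: IHB].
- move=> S A B D _ IHA _ IHB n HS.
  have HS' F : List.In F S -> slash G n F by move=> SF; apply: HS; right.
  case: (HS _ (or_introl erefl)) => H; [apply: IHA | apply: IHB];
    by move=> F [<-|/HS'].
- by move=> S A B _ IH n /IH; left.
- by move=> S A B _ IH n /IH; right.
- move=> S D _ IH n HS.
  have HS' F : List.In F S -> slash G n.+1 F.
    by move=> SF; apply: (HS (Nabla F)); apply: List.in_map.
  by have := IH _ HS'; case: D {IH}.
- move=> S A B D _ IHA _ IHB n HS.
  have HS' F : List.In F S -> slash G n F by move=> SF; apply: HS; right.
  have [_ AB] := HS _ (or_introl erefl).
  by apply: IHB => F [<-|/HS' //]; apply/AB/IHA.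
- move=> S A B SAB IH n HS; split.
    apply: STLN_multicut (RImp SAB) => F SF.
    exact/(slash_provable chainG)/HS.
  case: n HS => // n HS HA; apply: IH => F [<- //|].
  by case/List.in_map_iff=> F' [<-]; apply: HS.
Qed.

Lemma slash_nablan (V : Type) (G : nat -> seq (form V)) n p A :
  slash G n (nablan p A) = slash G (p + n) A.
Proof. by elim: p n => //= p IH n; rewrite IH addnS. Qed.

Lemma slash_bigAnd (V : Type) (G : nat -> seq (form V)) n s :
  (forall F, List.In F s -> slash G n F) -> slash G n (bigAnd s).
Proof.
elim: s => // F1 [|F2 s] IH Hs; first by apply: Hs; left.
by split; [apply: Hs; left | apply: IH => F sF; apply: Hs; right].
Qed.

(** * Visser's rules *)

Lemma In_image (I : finType) (T : Type) (f : I -> T) (P : {pred I}) x :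
  List.In x [seq f i | i in P] <-> exists2 i, i \in P & x = f i.
Proof.
have InE (s : seq I) i : List.In i s <-> i \in s.
  elim: s => //= j s IH; rewrite inE; split.
    by case=> [->|/IH ->]; rewrite ?eqxx ?orbT.
  by case/orP=> [/eqP->|/IH]; [left | right].
rewrite List.in_map_iff; split=> [[i [<- /InE]]|[i Pi ->]].
  by rewrite mem_enum => Pi; exists i.
by exists i; split=> //; apply/InE; rewrite mem_enum.
Qed.

(** The hypotheses seen from the [n]-th world: [n] nablas come off those
    that have as many. *)
Definition stripped (V : Type) (I : finType) (m : I -> nat)
    (E : I -> form V) (n : nat) : seq (form V) :=
  [seq nablan (m i - n) (E i) | i in [set i | n <= m i]].

Lemma In_stripped (V : Type) (I : finType) (m : I -> nat) (E : I -> form V) n i :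
  n <= m i -> List.In (nablan (m i - n) (E i)) (stripped m E n).
Proof. by move=> le_n_m; apply/In_image; exists i; rewrite ?inE. Qed.

Lemma stripped_chain (V : Type) (I : finType) (m : I -> nat) (E : I -> form V) :
  nabla_chain (stripped m E).
Proof.
move=> n F /In_image[i]; rewrite inE => lt_n_m ->; apply: STLN_ax.
rewrite -[Nabla _]/(nablan (m i - n.+1).+1 (E i)) subnSK //.
exact/In_stripped/ltnW.
Qed.

Lemma stripped0 (V : Type) (I : finType) (m : I -> nat) (E : I -> form V) :
  stripped m E 0 = [seq nablan (m i) (E i) | i : I].
Proof.
rewrite /stripped /image_mem.
rewrite (eq_map (g := fun i => nablan (m i) (E i))) => [|i]; last by rewrite subn0.
by congr map; apply: eq_enum => i; rewrite inE.
Qed.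

Theorem theorem16 (V : Type) (I : finType) (m : I -> nat) (k : nat)
  (A B : I -> form V) (C D : form V) :
  iKd (Imp (bigAnd [seq nablan (m i) (Imp (A i) (B i)) | i : I])
           (nablan k (Imp C D))) ->
  (exists i0 : I, (1 <= m i0)%N /\
     iKd (Imp (bigAnd [seq nablan (m i) (Imp (A i) (B i)) | i : I])
              (nablan (m i0 - 1) (A i0))))
  \/
  (exists I' : {set I}, (forall i : I, i \in I' -> (k <= m i)%N) /\
     iKd (Imp (And (bigAnd [seq nablan (m i - k + 1) (Imp (A i) (B i)) | i in I'])
                   C)
              D)).
Proof.
set E := fun i => Imp (A i) (B i).
rewrite -(stripped0 m E); set G := stripped m E.
have chainG : nabla_chain G by apply: stripped_chain.
move=> /iKd_imp premise.
have [|no_first] := classic (exists i0 : I, (1 <= m i0)%N /\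
     iKd (Imp (bigAnd (G 0)) (nablan (m i0 - 1) (A i0)))); first by left.
right; exists [set i | k <= m i]; split=> [i|]; first by rewrite inE.
have slash_hyps : slash G 0 (bigAnd (G 0)).
  apply: slash_bigAnd => F /In_image[i _ ->].
  rewrite subn0 slash_nablan addn0; split.
    by apply: STLN_ax; rewrite -[Imp _ _]/(nablan 0 (E i)) -(subnn (m i));
      apply: In_stripped.
  case def_m: (m i) => [//|p] slashA; case: no_first.
  exists i; rewrite def_m subn1; split=> //; apply/iKd_imp/STLN_bigAnd_left.
  exact/(nabla_chain_root chainG)/(slash_provable chainG).
have: slash G 0 (nablan k (Imp C D)).
  by apply: (slash_sound chainG premise) => F [<-|].
rewrite slash_nablan addn0 => -[/STLN_imp_inv GkCD _].
apply/iKd_imp/(STLN_multicut _ GkCD) => F [<-|]; first exact/LAnd2/Id.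
case/List.in_map_iff=> F' [<- /In_image[i mi ->]].
apply/LAnd1/STLN_bigAnd_elim/In_image; exists i => //.
by rewrite addn1.
Qed.
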